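(* Let $e>r\ge 3$ and $w\ge 0$ be integers. Then $$|\mathcal{W}_{r,e,w}|=\sum_{\mu\models r}A(\mu;w)\binom{e-1}{\ell(\mu)-1},$$ where the sum is over all compositions $\mu$ of $r$ and $\ell(\mu)$ denotes the length of $\mu$.
   Context: A composition of $r$ is a finite sequence of positive integers with sum $r$; its length is its number of terms. A partition is a finite weakly decreasing sequence $\lambda=(\lambda_1,\lambda_2,\dots)$ of positive integers with $\ell(\lambda)$ parts and size $|\lambda|$ (the empty partition is allowed); set $\lambda_i=0$ for $i>\ell(\lambda)$. For a composition $\mu=(\mu_1,\dots,\mu_j)$, $A(\mu;w)$ is the number of $j$-tuples of partitions $(q^{(1)},\dots,q^{(j)})$ with $\sum_i|q^{(i)}|=w$ and $\ell(q^{(i)})\le\mu_i$ for all $i$. If $\ell(\lambda)\le r$, the $r$-beta numbers of $\lambda$ are $\beta_i(\lambda)=\lambda_i+r-i$ for $1\le i\le r$. The $e$-abacus of $\lambda$ with $r$ beads has runners $0,\dots,e-1$ and rows $0,1,2,\dots$; the bead $\beta_i(\lambda)=ae+b$, $0\le b\le e-1$, is placed in row $a$ of runner $b$. Sliding a bead up means moving it from position $x$ to the empty position $x-e\ge 0$. The $e$-weight $w_e(\lambda)$ is the total number of one-step upward slides needed until no further slide is possible. Let $P=\bigoplus_{i=1}^{r-1}\mathbb{Z}\Lambda_i$ be the weight lattice of $\mathfrak{sl}_r$ with fundamental weights $\Lambda_i$, and put $\Omega(\lambda)=\sum_{i=1}^{r-1}(\beta_i(\lambda)-\beta_{i+1}(\lambda))\Lambda_i$.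 Then $\mathcal{W}_{r,e,w}=\{\Omega(\lambda):\lambda\text{ a partition},\ \ell(\lambda)\le r,\ w_e(\lambda)=w\}$. *)

(* Defs.v *)
From mathcomp Require Import all_boot all_order all_algebra finmap.
From mathcomp Require Import boolp classical_sets functions cardinality.

Set Implicit Arguments.
Unset Strict Implicit.
Unset Printing Implicit Defensive.

Import GRing.Theory.

Local Open Scope classical_set_scope.
Local Open Scope nat_scope.

Definition is_composition (r : nat) (mu : seq nat) : bool :=
  all (ltn 0) mu && (sumn mu == r).

Definition is_intpart (lambda : seq nat) : bool :=
  sorted geq lambda && all (ltn 0) lambda.

Definition compositions (r : nat) : set (seq nat) :=
  [set mu | is_composition r mu].

Definition multipartitions (mu : seq nat) (w : nat) : set (seq (seq nat)) :=
  [set q | [/\ size q = size mu,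
               all is_intpart q,
               \sum_(i < size mu) sumn (nth [::] q i) = w &
               forall i, i < size mu -> size (nth [::] q i) <= nth 0 mu i]].

(* [fset_set] is [fset0] on infinite sets; [compositions] and [multipartitions]
   are proved finite below. *)
Definition A (mu : seq nat) (w : nat) : nat :=
  #|` fset_set (multipartitions mu w)|.

(* Indices start at 0: this is the beta number of index i + 1. *)
Definition beta (r : nat) (lambda : seq nat) (i : nat) : nat :=
  nth 0 lambda i + (r - i.+1).

(* The position x stands for row x %/ e of runner x %% e of the e-abacus. *)
Definition beads (r : nat) (lambda : seq nat) : {fset nat} :=
  [fset beta r lambda (i : 'I_r) | i in 'I_r]%fset.

Definition slide (e : nat) (B C : {fset nat}) : Prop :=
  exists2 x, x \in B &
    [/\ e <= x, x - e \notin B & C = ((x - e) |` (B `\ x))%fset].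

Fixpoint slides (e n : nat) (B C : {fset nat}) : Prop :=
  if n is m.+1 then exists2 D, slide e B D & slides e m D C else B = C.

(* The e-weight of a bead configuration, as a relation; [has_weight_unique]
   shows that it is a function of the configuration. *)
Definition has_weight (e : nat) (B : {fset nat}) (w : nat) : Prop :=
  exists2 C, slides e w B C & forall D, ~ slide e C D.

(* The weight lattice of sl_r, free on the fundamental weights, is 'rV_r.-1. *)
Definition fundamental_weight (r : nat) (i : 'I_r.-1) : 'rV[int]_r.-1 :=
  delta_mx 0%R i.

Definition Omega (r : nat) (lambda : seq nat) : 'rV[int]_r.-1 :=
  (\sum_(i < r.-1)
     ((beta r lambda i)%:Z - (beta r lambda i.+1)%:Z) *:
       fundamental_weight i)%R.

Definition Wset (r e w : nat) : set 'rV[int]_r.-1 :=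
  [set Omega r lambda | lambda in
    [set lambda | [/\ is_intpart lambda, size lambda <= r &
                      has_weight e (beads r lambda) w]]].

Arguments Wset : clear implicits.

Lemma finite_bounded_seqs (T : choiceType) (X : set T) (n : nat) :
  finite_set X ->
  finite_set [set s : seq T | size s <= n /\ forall x, x \in s -> X x].
Proof.
move=> finX; elim: n => [|n IHn].
  apply: (@sub_finite_set _ _ [set` [:: [::]]]); last exact: finite_seq.
  by move=> [|x s] [] //= _ _.
pose S := [set s : seq T | size s <= n /\ forall x, x \in s -> X x].
apply: (@sub_finite_set _ _ ([set [::]] `|`
  [set p.1 :: p.2 | p in X `*` S])).
  move=> [|x s] [] /= ss sX; first by left.
  right; exists (x, s) => //; split; first by apply: sX; rewrite inE eqxx.
  by split=> // y ys; apply: sX; rewrite inE ys orbT.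
rewrite finite_setU; split; first exact: finite_set1.
by apply: finite_image; apply: finite_setX.
Qed.

Lemma mem_leq_sumn (s : seq nat) x : x \in s -> x <= sumn s.
Proof.
elim: s => //= y s IHs; rewrite inE => /orP[/eqP-> | /IHs le_xs].
  exact: leq_addr.
exact: leq_trans le_xs (leq_addl _ _).
Qed.

Lemma size_leq_sumn (s : seq nat) : all (ltn 0) s -> size s <= sumn s.
Proof. by elim: s => //= x s IHs /andP[x_gt0 /IHs le_s]; rewrite -addn1 addnC leq_add. Qed.

Lemma finite_pos_seqs (n : nat) :
  finite_set [set s : seq nat | all (ltn 0) s /\ sumn s <= n].
Proof.
apply: sub_finite_set (finite_bounded_seqs n (finite_II n.+1)).
move=> s [s_gt0 le_sn]; split; first exact: leq_trans (size_leq_sumn s_gt0) _.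
by move=> x /mem_leq_sumn le_xs; rewrite /= ltnS (leq_trans le_xs).
Qed.

Lemma finite_compositions (r : nat) : finite_set (compositions r).
Proof.
apply: sub_finite_set (finite_pos_seqs r) => s /andP[s_gt0 /eqP<-].
by split.
Qed.

Lemma finite_multipartitions (mu : seq nat) (w : nat) :
  finite_set (multipartitions mu w).
Proof.
apply: sub_finite_set (finite_bounded_seqs (size mu) (finite_pos_seqs w)).
move=> q [szq /allP qP sumq _]; split; first by rewrite szq.
move=> p pq; split; first by have /andP[] := qP _ pq.
have lt_p : index p q < size mu by rewrite -szq index_mem.
rewrite -sumq (bigD1 (Ordinal lt_p)) //= nth_index //.
exact: leq_addr.
Qed.

Section WeightUnique.

Variables (e : nat) (e_gt0 : 0 < e).

Let total (B : {fset nat}) := \sum_(x <- B) x.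
Let runner b (B : {fset nat}) := [seq x <- B | x %% e == b].

Lemma big_slide (F : nat -> nat) (B : {fset nat}) x :
  x \in B -> x - e \notin B ->
  \sum_(y <- ((x - e) |` (B `\ x))%fset) F y + F x =
  \sum_(y <- B) F y + F (x - e).
Proof.
move=> xB xeB; rewrite big_fsetU1 /=; last first.
  by rewrite !inE negb_and (negbTE xeB) orbT.
rewrite [in RHS](big_fsetD1 x) //=.
by rewrite -addnA [RHS]addnC; congr addn; apply: addnC.
Qed.

Lemma slide_total B C : slide e B C -> total B = total C + e.
Proof.
case=> x xB [le_ex xeB ->]; apply: (@addIn (x - e)).
by rewrite /total -(big_slide id xB xeB) /= -addnA (subnKC le_ex).
Qed.

Lemma slide_runner b B C :
  slide e B C -> size (runner b B) = size (runner b C).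
Proof.
case=> x xB [le_ex xeB ->]; rewrite !size_filter -!sum1_count.
rewrite big_mkcond [RHS]big_mkcond /=.
apply: (@addIn (if x %% e == b then 1 else 0)).
rewrite (big_slide (fun y => if y %% e == b then 1 else 0) xB xeB).
by rewrite -{1}(subnK le_ex) modnDr.
Qed.

Lemma slides_total n B C : slides e n B C -> total B = total C + n * e.
Proof.
elim: n B => [|n IHn] B /=; first by move->; rewrite addn0.
by case=> D /slide_total-> /IHn->; rewrite mulSn -addnA [e + _]addnC.
Qed.

Lemma slides_runner b n B C :
  slides e n B C -> size (runner b B) = size (runner b C).
Proof.
elim: n B => [|n IHn] B /=; first by move->.
by case=> D /(slide_runner b)-> /IHn->.
Qed.

Lemma slid_closed C x y : (forall D, ~ slide e C D) ->
  x \in C -> y <= x -> y %% e = x %% e -> y \in C.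
Proof.
move=> slidC xC le_yx eq_m.
have : exists k, y + k * e = x.
  exists (x %/ e - y %/ e); rewrite {1}(divn_eq y e) eq_m addnAC -mulnDl.
  by rewrite subnKC ?leq_div2r // -divn_eq.
case=> k; elim: k x xC {le_yx eq_m} => [|k IHk] x xC eq_x.
  by rewrite -eq_x addn0 in xC.
have le_ex : e <= x by rewrite -eq_x mulSn addnCA leq_addr.
apply: (IHk (x - e)); last by rewrite -eq_x mulSn addnCA addKn.
by apply: contraPT (slidC ((x - e) |` (C `\ x))%fset) => xeC; apply; exists x.
Qed.

Lemma slid_sub C D : (forall E, ~ slide e C E) -> (forall E, ~ slide e D E) ->
  (forall b, size (runner b C) = size (runner b D)) -> {subset C <= D}.
Proof.
move=> slidC slidD eq_CD x xC; apply: contraT => xD.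
pose b := x %% e.
have xrC : x \in runner b C by rewrite mem_filter eqxx.
have sub_DC : {subset runner b D <= runner b C}.
  move=> y; rewrite !mem_filter => /andP[/eqP yb yD]; rewrite yb eqxx /=.
  apply: (slid_closed slidC xC) => //; rewrite leqNgt.
  by apply: contra xD => /ltnW le_xy; apply: (slid_closed slidD yD).
have uD : uniq (runner b D) by rewrite filter_uniq ?fset_uniq.
have [_ eq_mem] := uniq_min_size uD sub_DC (eq_leq (eq_CD b)).
by move: xrC; rewrite -eq_mem mem_filter (negbTE xD) andbF.
Qed.

Lemma has_weight_unique B : exists! w, has_weight e B w.
Proof.
have exw : exists w, has_weight e B w.
  have [n] := ubnP (total B); elim: n B => // n IHn B.
  rewrite ltnS => le_Bn.
  have [[C BC]|nBC] := pselect (exists C, slide e B C); last first.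
    by exists 0, B => //= D BD; apply: nBC; exists D.
  have [|w [D CD slidD]] := IHn C.
    apply: leq_trans le_Bn; rewrite (slide_total BC) -addn1 leq_add2l.
    exact: e_gt0.
  by exists w.+1, D => //; exists C.
case: exw => w [C BC slidC]; exists w; split; first by exists C.
move=> v [D BD slidD].
have eq_CD : C = D.
  have eq_r b : size (runner b C) = size (runner b D).
    by rewrite -(slides_runner b BC) (slides_runner b BD).
  by apply/fsetP => x; apply/idP/idP; apply/slid_sub.
have := slides_total BC; rewrite (slides_total BD) eq_CD => /addnI/eqP.
by rewrite eqn_pmul2r // => /eqP.
Qed.

End WeightUnique.

(* Main.v *)
(* Omega(lambda) determines the beads of lambda up to translation. Translating by
   one moves the beads of runner e - 1 one row down and to runner 0 and keeps the
   rows of the other beads, so the weight increases by the number of beads on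
   runner e - 1. Hence each element of W_{r,e,w} has exactly one representative of
   weight w whose runner e - 1 is nonempty (the last translate of weight w).
   Such a bead configuration amounts to the set of its nonempty runners other
   than e - 1 (l - 1 of the remaining e - 1), the numbers mu_1, ..., mu_l of beads
   on the nonempty runners, and for each of them the partition with at most mu_i
   parts whose mu_i-beta numbers are its occupied rows; the weight is the total
   size of these partitions. *)
Require Import Defs.
From mathcomp Require Import all_boot all_order all_algebra finmap.
From mathcomp Require Import boolp classical_sets functions cardinality.
From mathcomp Require Import zify.

Set Implicit Arguments.
Unset Strict Implicit.
Unset Printing Implicit Defensive.

Local Open Scope classical_set_scope.
Local Open Scope nat_scope.
Local Open Scope card_scope.

(** * Beta numbers *)

(** The zeros of a weakly decreasing sequence form its tail, so deleting them only replaces entries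
    0 by the default value 0. *)
Lemma nth_filter_pos (s : seq nat) i :
  sorted geq s -> nth 0 [seq x <- s | 0 < x] i = nth 0 s i.
Proof.
have geq_trans : transitive geq by move=> m n p /= le_mn /leq_trans->.
elim: s i => [|x s IHs] i //= s_sorted; case: ifP => [_|].
  by case: i => //= i; rewrite IHs ?(path_sorted s_sorted).
move/negbT; rewrite -leqNgt leqn0 => /eqP x0; subst x.
have s0 : all (fun y => y == 0) s.
  by move: (order_path_min geq_trans s_sorted); apply: sub_all => y /=; rewrite leqn0.
rewrite (eq_in_filter (a2 := pred0)) => [|y /(allP s0)/eqP-> //].
rewrite filter_pred0 nth_nil; case: i => //= i.
have [lt_i|le_i] := ltnP i (size s); last by rewrite nth_default.
by rewrite (eqP (allP s0 _ (mem_nth 0 lt_i))).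
Qed.

Lemma intpart_eq (lambda kappa : seq nat) :
  is_intpart lambda -> is_intpart kappa ->
  nth 0 lambda =1 nth 0 kappa -> lambda = kappa.
Proof.
move=> /andP[_ /allP lP] /andP[_ /allP kP] eq_nth.
have eq_sz : size lambda = size kappa.
  apply/eqP; rewrite eqn_leq; apply/andP; split; rewrite leqNgt; apply/negP => lt_sz.
    by have := lP _ (mem_nth 0 lt_sz); rewrite /= eq_nth nth_default.
  by have := kP _ (mem_nth 0 lt_sz); rewrite /= -eq_nth nth_default.
by apply: (eq_from_nth (x0 := 0)).
Qed.

(** Strict decrease forces [f i >= n - i.+1], by descending induction on [i]. Subtracting the
    staircase therefore leaves a weakly decreasing sequence, whose positive terms are the
    partition. *)
Lemma beta_surj n (f : nat -> nat) :
  (forall i j, i < j -> j < n -> f j < f i) ->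
  exists lambda, [/\ is_intpart lambda, size lambda <= n &
                     forall i, i < n -> beta n lambda i = f i].
Proof.
move=> f_dec.
have f_ge i : i < n -> n - i.+1 <= f i.
  move=> lt_in; have [k] : exists k, k = n - i.+1 by exists (n - i.+1).
  elim: k i lt_in => [|k IHk] i lt_in eq_k; first by rewrite -eq_k.
  have lt_i1 : i.+1 < n by lia.
  have := IHk i.+1 lt_i1; have := f_dec i i.+1 (ltnSn i) lt_i1; lia.
pose g i := f i - (n - i.+1).
have s_sorted : sorted geq (mkseq g n).
  apply/(sortedP 0) => i; rewrite size_mkseq => lt_i.
  rewrite !nth_mkseq //=; last exact: ltnW.
  rewrite /g; have := f_dec i i.+1 (ltnSn i) lt_i; lia.
exists [seq x <- mkseq g n | 0 < x]; split.
- rewrite /is_intpart filter_all andbT sorted_filter //.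
  by move=> m p q /= le_mn /leq_trans->.
- by rewrite size_filter (leq_trans (count_size _ _)) // size_mkseq.
- move=> i lt_in; rewrite /beta nth_filter_pos // nth_mkseq // subnK //.
  exact: f_ge.
Qed.

Lemma beta_dec n lambda i j :
  is_intpart lambda -> i < j -> j < n -> beta n lambda j < beta n lambda i.
Proof.
move=> /andP[l_sorted _] lt_ij lt_jn; rewrite /beta.
suff : nth 0 lambda j <= nth 0 lambda i by lia.
have [lt_j|le_j] := ltnP j (size lambda); last by rewrite nth_default.
have geq_trans : transitive geq by move=> m p q /= le_mn /leq_trans->.
apply: (sorted_leq_nth geq_trans leqnn 0 l_sorted); rewrite ?inE ?(ltnW lt_ij) //.
exact: ltn_trans lt_ij lt_j.
Qed.

Lemma beta_inj n lambda kappa :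
  is_intpart lambda -> size lambda <= n -> is_intpart kappa -> size kappa <= n ->
  (forall i, i < n -> beta n lambda i = beta n kappa i) -> lambda = kappa.
Proof.
move=> lP szl kP szk eq_b; apply: intpart_eq => // i.
have [lt_in|le_ni] := ltnP i n.
  by have := eq_b _ lt_in; rewrite /beta => /addIn.
by rewrite !nth_default // ?(leq_trans szl) ?(leq_trans szk).
Qed.

Lemma perm_beads n lambda : is_intpart lambda ->
  perm_eq (beads n lambda) (mkseq (beta n lambda) n).
Proof.
move=> lP; rewrite -[mkseq _ _]/(map _ _) -val_enum_ord -map_comp.
apply: uniq_perm; rewrite ?fset_uniq //.
  rewrite map_inj_uniq ?enum_uniq // => i j /= eq_ij; apply: val_inj => /=.
  case: (ltngtP i j) => // lt_ij.
    by have := beta_dec lP lt_ij (ltn_ord j); rewrite eq_ij ltnn.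
  by have := beta_dec lP lt_ij (ltn_ord i); rewrite eq_ij ltnn.
move=> x; apply/imfsetP/mapP => [[i _ ->]|[i _ ->]]; exists i => //.
by rewrite mem_enum.
Qed.

Lemma card_beads n lambda : is_intpart lambda -> #|` beads n lambda| = n.
Proof. by move/(perm_beads n)/perm_size; rewrite size_mkseq. Qed.

Lemma big_beads n lambda (F : nat -> nat) : is_intpart lambda ->
  \sum_(x <- beads n lambda) F x = \sum_(i < n) F (beta n lambda i).
Proof.
move=> lP; rewrite (perm_big _ (perm_beads n lP)) /= big_map.
by rewrite -{1}[n]subn0 -/(index_iota 0 n) big_mkord.
Qed.

Lemma mem_beads n lambda x :
  reflect (exists2 i, i < n & x = beta n lambda i) (x \in beads n lambda).
Proof.
apply: (iffP (imfsetP _ _ _ _)) => [[i _ ->]|[i lt_in ->]].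
  by exists (nat_of_ord i).
by exists (Ordinal lt_in).
Qed.

Lemma sorted_mkseq_gtn n (f : nat -> nat) :
  (forall i j, i < j -> j < n -> f j < f i) -> sorted gtn (mkseq f n).
Proof.
move=> f_dec; apply/(sortedP 0) => i; rewrite size_mkseq => lt_i.
by rewrite !nth_mkseq //= ?f_dec // ltnW.
Qed.

(** A strictly decreasing sequence is determined by its set of values, so the bead set recovers the
    beta numbers in order. *)
Lemma beads_inj n lambda kappa :
  is_intpart lambda -> size lambda <= n -> is_intpart kappa -> size kappa <= n ->
  beads n lambda = beads n kappa -> lambda = kappa.
Proof.
move=> lP szl kP szk eq_b; apply: (beta_inj lP szl kP szk) => i lt_in.
have gtn_trans : transitive gtn by move=> m p q /= lt_mp /ltn_trans->.
suff eq_s : mkseq (beta n lambda) n = mkseq (beta n kappa) n.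
  by rewrite -(nth_mkseq 0 (beta n lambda) lt_in) eq_s nth_mkseq.
apply: (irr_sorted_eq gtn_trans ltnn).
- by apply: sorted_mkseq_gtn => *; apply: beta_dec.
- by apply: sorted_mkseq_gtn => *; apply: beta_dec.
by move=> x; rewrite -(perm_mem (perm_beads n lP)) eq_b (perm_mem (perm_beads n kP)).
Qed.

Lemma beads_surj (B : {fset nat}) :
  exists lambda, [/\ is_intpart lambda, size lambda <= #|` B| &
                     beads #|` B| lambda = B].
Proof.
have gtn_trans : transitive gtn by move=> m p q /= lt_mp /ltn_trans->.
pose s := sort geq B.
have sz_s : size s = #|` B| by rewrite size_sort.
have s_sorted : sorted gtn s.
  rewrite gtn_sorted_uniq_geq sort_uniq fset_uniq /=.
  by apply: sort_sorted => x y /=; apply: leq_total.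
have [|lambda [lP szl eq_b]] := @beta_surj #|` B| (nth 0 s).
  move=> i j lt_ij; rewrite -sz_s => lt_j.
  apply: (sorted_ltn_nth gtn_trans 0 s_sorted) => //; rewrite inE //.
  exact: ltn_trans lt_ij lt_j.
exists lambda; split=> //; apply/fsetP => x.
rewrite -[in RHS](mem_sort geq) -/s; apply/mem_beads/idP => [[i lt_i ->]|x_s].
  by rewrite eq_b // mem_nth // sz_s.
have lt_x : index x s < #|` B| by rewrite -sz_s index_mem.
by exists (index x s) => //; rewrite eq_b // nth_index.
Qed.

(* Both sides are doubled so that the n(n-1)/2 coming from the staircase
   n-1, ..., 0 needs no division. *)
Lemma sum_beads n lambda : is_intpart lambda -> size lambda <= n ->
  2 * (\sum_(x <- beads n lambda) x) + n = 2 * sumn lambda + n * n.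
Proof.
move=> lP szl; rewrite (big_beads n (fun x => x) lP) /beta big_split /=.
have -> : \sum_(i < n) nth 0 lambda i = sumn lambda.
  rewrite sumnE (big_nth 0) big_mkord (big_ord_widen _ (fun i => nth 0 lambda i) szl).
  rewrite [RHS]big_mkcond /=; apply: eq_bigr => i _.
  by case: ltnP => // le_i; rewrite nth_default.
suff sum_stairs : 2 * (\sum_(i < n) (n - i.+1)) + n = n * n.
  by rewrite mulnDr -addnA sum_stairs.
elim: n {szl} => [|n IHn]; first by rewrite big_ord0.
rewrite big_ord_recl /=; under eq_bigr do rewrite /bump /= add1n subSS.
rewrite subSS subn0; move: IHn; set s := \sum_(i < n) _; nia.
Qed.

(** * The weight of a bead configuration *)

Definition rowsum (e : nat) (B : {fset nat}) := \sum_(x <- B) x %/ e.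

(** The sum of the squares of the numbers of beads on the runners: pairs are ordered and the
    diagonal is included. *)
Definition congr_pairs (e : nat) (B : {fset nat}) :=
  \sum_(x <- B) \sum_(y <- B) (x %% e == y %% e).

(** A slide only exchanges [x] for [x - e]. This one invariance yields both that of the number of
    beads (constant [F]) and that of [congr_pairs]. *)
Lemma slide_periodic e B C (F : nat -> nat) : slide e B C ->
  (forall x, e <= x -> F (x - e) = F x) -> \sum_(x <- C) F x = \sum_(x <- B) F x.
Proof.
case=> x xB [le_ex xeB ->] FP; apply: (@addIn (F x)).
by rewrite (big_slide F xB xeB) FP.
Qed.

Lemma modn_subr e x : e <= x -> (x - e) %% e = x %% e.
Proof. by move=> le_ex; rewrite -{2}(subnK le_ex) modnDr. Qed.

Lemma slide_congr_pairs e B C : slide e B C -> congr_pairs e C = congr_pairs e B.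
Proof.
move=> BC; rewrite /congr_pairs.
rewrite (slide_periodic (F := fun x => \sum_(y <- C) (x %% e == y %% e)) BC); last first.
  by move=> x le_ex; rewrite modn_subr.
apply: eq_bigr => x _.
apply: (slide_periodic (F := fun y => (x %% e == y %% e) : nat) BC).
by move=> y le_ey; rewrite modn_subr.
Qed.

Lemma slide_card e B C : slide e B C -> #|` C| = #|` B|.
Proof.
move=> BC; have := slide_periodic (F := fun=> 1) BC (fun _ _ => erefl).
by rewrite !sum1_size.
Qed.

Lemma slide_rowsum e B C : 0 < e -> slide e B C -> rowsum e B = (rowsum e C).+1.
Proof.
move=> e_gt0 [x xB [le_ex xeB ->]].
have := big_slide (fun y => y %/ e) xB xeB; rewrite -/(rowsum e B).
have -> : x %/ e = ((x - e) %/ e).+1.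
  by rewrite -{1}(subnK le_ex) divnDr ?dvdnn // divnn e_gt0 addn1.
rewrite -/(rowsum e (((x - e) |` (B `\ x))%fset)); lia.
Qed.

(** With no slide left, the row of a bead is the number of beads above it on its runner. Summing
    this twice counts the ordered pairs of distinct congruent beads; the diagonal adds the number of
    beads. *)
Lemma slid_rowsum e C : 0 < e -> (forall D, ~ slide e C D) ->
  2 * rowsum e C + #|` C| = congr_pairs e C.
Proof.
move=> e_gt0 slidC; rewrite /congr_pairs /rowsum.
pose lower x y : nat := (y < x) && (y %% e == x %% e).
have lowerE x : x \in C -> \sum_(y <- C) lower x y = x %/ e.
  move=> xC; rewrite -big_mkcond /= sum1_count -size_filter.
  (* By [slid_closed], every row [k < x %/ e] of the runner of [x] is occupied, so [k * e + x %% e]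
     enumerates the beads counted. *)
  rewrite -[RHS](size_iota 0) -[RHS](size_map (fun k => k * e + x %% e)).
  apply: perm_size; apply: uniq_perm; first by rewrite filter_uniq ?fset_uniq.
    rewrite map_inj_uniq ?iota_uniq // => k l /addIn/eqP.
    by rewrite eqn_pmul2r // => /eqP.
  move=> y; rewrite mem_filter; apply/andP/mapP.
    case=> /andP[lt_yx /eqP eq_yx] yC; exists (y %/ e); last first.
      by rewrite -eq_yx -divn_eq.
    rewrite mem_iota /= add0n ltnNge; apply: contraTN lt_yx => le_xy.
    rewrite -leqNgt (divn_eq x e) (divn_eq y e) eq_yx leq_add2r leq_mul2r.
    by rewrite le_xy orbT.
  case=> k; rewrite mem_iota /= add0n => lt_k ->.
  have lt_kx : k * e + x %% e < x.
    by rewrite [ltnRHS](divn_eq x e) ltn_add2r ltn_pmul2r.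
  have eq_m : (k * e + x %% e) %% e = x %% e by rewrite modnMDl modn_mod.
  by rewrite lt_kx eq_m eqxx (slid_closed slidC xC (ltnW lt_kx) eq_m).
(* For fixed [x], a congruent [y] is smaller than [x], larger, or equal to it; exchanging the two
   sums shows that the first two cases contribute equally in total. *)
transitivity (\sum_(x <- C) (\sum_(y <- C) lower x y + \sum_(y <- C) lower y x + 1)).
  rewrite !big_split /= sum1_size [X in _ = _ + X + _]exchange_big /= addnn -mul2n.
  by rewrite (eq_big_seq _ lowerE).
apply: eq_big_seq => x xC; rewrite -big_split /=.
rewrite (big_fsetD1 x) //= [RHS](big_fsetD1 x) //= eqxx /lower ltnn addnC addnA.
congr addn; rewrite ?addn0 //; apply: eq_big_seq => y; rewrite !inE => /andP[neq_yx _].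
by rewrite [y %% e == _]eq_sym; case: ltngtP neq_yx; rewrite ?eqxx //= ?addn0.
Qed.

Lemma slides_weight e n B C : 0 < e -> slides e n B C ->
  [/\ rowsum e B = rowsum e C + n, #|` B| = #|` C| &
      congr_pairs e B = congr_pairs e C].
Proof.
move=> e_gt0; elim: n B => [|n IHn] B /=; first by move->; rewrite addn0.
case=> D BD /IHn[eq_s eq_c eq_p]; split.
- by rewrite (slide_rowsum e_gt0 BD) eq_s addnS.
- by rewrite -(slide_card BD).
- by rewrite -(slide_congr_pairs BD).
Qed.

(* Once slid, the n_b beads of runner b fill rows 0, ..., n_b - 1, of total
   n_b (n_b - 1) / 2; twice the sum of these over b is [congr_pairs e B - #|` B|],
   and this does not change under slides. *)
Lemma has_weightE e B w : 0 < e ->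
  has_weight e B w <-> 2 * rowsum e B + #|` B| = 2 * w + congr_pairs e B.
Proof.
move=> e_gt0.
have wE v : has_weight e B v -> 2 * rowsum e B + #|` B| = 2 * v + congr_pairs e B.
  case=> C BC slidC; have [-> -> ->] := slides_weight e_gt0 BC.
  have := slid_rowsum e_gt0 slidC; lia.
split=> [/wE //|eq_w].
(* Conversely, some weight exists, and the equation just proved identifies it with [w]. *)
have [v [Bv _]] := has_weight_unique e_gt0 B.
have <- : v = w by have := wE v Bv; lia.
by [].
Qed.

(** * Reading a bead configuration by runners *)

(** [T] is indexed by the place of a runner in the list [rs], not by the runner itself, so that the
    lists of parts and of partitions can share its indices. *)
Definition abacus (e : nat) (rs : seq nat) (T : nat -> {fset nat}) : {fset nat} :=
  [fset x in [seq a * e + nth 0 rs i | i <- iota 0 (size rs), a <- T i]%N]%fset.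

Section Abacus.

Variables (e : nat) (rs : seq nat) (T : nat -> {fset nat}).
Hypotheses (uniq_rs : uniq rs) (rs_lt : {in rs, forall b, b < e}).

Let e_gt0 i : i < size rs -> 0 < e.
Proof. by move/(mem_nth 0)/rs_lt; apply: leq_trans. Qed.

Let div_pos a i : i < size rs -> (a * e + nth 0 rs i) %/ e = a.
Proof.
move=> lt_i; rewrite divnMDl ?(e_gt0 lt_i) // divn_small ?addn0 //.
by rewrite rs_lt ?mem_nth.
Qed.

Let mod_pos a i : i < size rs -> (a * e + nth 0 rs i) %% e = nth 0 rs i.
Proof. by move=> lt_i; rewrite modnMDl modn_small ?rs_lt ?mem_nth. Qed.

Lemma mem_abacus x :
  (x \in abacus e rs T) = (x %% e \in rs) && (x %/ e \in T (index (x %% e) rs)).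
Proof.
rewrite inE /=; apply/allpairsPdep/andP.
  case=> i [a []]; rewrite mem_iota /= => lt_i aT ->.
  by rewrite div_pos // mod_pos // mem_nth // index_uniq.
case=> x_rs xT; exists (index (x %% e) rs), (x %/ e).
by rewrite mem_iota index_mem x_rs nth_index // -divn_eq.
Qed.

Lemma mem_abacus_nth i a : i < size rs ->
  (a * e + nth 0 rs i \in abacus e rs T) = (a \in T i).
Proof.
by move=> lt_i; rewrite mem_abacus div_pos // mod_pos // mem_nth // index_uniq.
Qed.

Lemma big_abacus (F : nat -> nat) : \sum_(x <- abacus e rs T) F x =
  \sum_(i < size rs) \sum_(a <- T i) F (a * e + nth 0 rs i).
Proof.
have uL : uniq [seq a * e + nth 0 rs i | i <- iota 0 (size rs), a <- T i].
  apply: allpairs_uniq_dep; [exact: iota_uniq|by move=> i _; apply: fset_uniq|].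
    move=> [i a] [j b] /allpairsPdep[i' [a' [+ _ [-> ->]]]].
  rewrite mem_iota /= => lt_i /allpairsPdep[j' [b' [+ _ [-> ->]]]].
  rewrite mem_iota /= => lt_j eq_x.
  have eq_ij : i' = j'.
    apply/eqP; rewrite -(nth_uniq 0 lt_i lt_j uniq_rs) -(mod_pos a' lt_i) eq_x.
    by rewrite mod_pos.
  by subst j'; rewrite -(div_pos a' lt_i) eq_x div_pos.
have perm_L : perm_eq (abacus e rs T)
    [seq a * e + nth 0 rs i | i <- iota 0 (size rs), a <- T i].
  by apply: uniq_perm; rewrite ?fset_uniq // => x; rewrite inE.
rewrite (perm_big _ perm_L) /= big_allpairs_dep /=.
by rewrite -{1}[size rs]subn0 -/(index_iota 0 _) big_mkord.
Qed.

Lemma card_abacus : #|` abacus e rs T| = \sum_(i < size rs) #|` T i|.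
Proof.
by rewrite -sum1_size big_abacus; apply: eq_bigr => i _; rewrite sum1_size.
Qed.

Lemma rowsum_abacus :
  rowsum e (abacus e rs T) = \sum_(i < size rs) \sum_(a <- T i) a.
Proof.
rewrite /rowsum big_abacus; apply: eq_bigr => i _.
by apply: eq_bigr => a _; rewrite div_pos.
Qed.

(** Distinct places in [rs] carry distinct residues, so only pairs on the same runner contribute. *)
Lemma congr_pairs_abacus :
  congr_pairs e (abacus e rs T) = \sum_(i < size rs) #|` T i| * #|` T i|.
Proof.
rewrite /congr_pairs big_abacus; apply: eq_bigr => i _.
transitivity (\sum_(a <- T i) #|` T i|); last first.
  by rewrite big_const_seq count_predT iter_addn_0.
apply: eq_bigr => a _.
rewrite big_abacus (bigD1 i) //= [X in _ + X]big1 ?addn0 => [|j neq_ji].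
  by rewrite -[RHS]sum1_size; apply: eq_bigr => b _; rewrite !mod_pos ?eqxx.
rewrite big1 // => b _; rewrite !mod_pos // nth_uniq //.
by rewrite eq_sym -[_ == _]/(j == i) (negbTE neq_ji).
Qed.

End Abacus.

(** By [sum_beads], runner [i] contributes twice the size of its partition plus the square of [mu_i]
    to the left side of [has_weightE]; the squares cancel against [congr_pairs]. *)
Lemma weight_abacus e rs (mu : seq nat) (q : seq (seq nat)) w :
  0 < e -> uniq rs -> {in rs, forall b, b < e} ->
  size mu = size rs -> size q = size rs -> all is_intpart q ->
  (forall i, i < size rs -> size (nth [::] q i) <= nth 0 mu i) ->
  has_weight e (abacus e rs (fun i => beads (nth 0 mu i) (nth [::] q i))) w <->
  \sum_(i < size rs) sumn (nth [::] q i) = w.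
Proof.
move=> e_gt0 uniq_rs rs_lt sz_mu sz_q /allP qP le_q.
have qiP (i : 'I_(size rs)) : is_intpart (nth [::] q i).
  by apply/qP/mem_nth; rewrite sz_q.
rewrite has_weightE // rowsum_abacus // congr_pairs_abacus // card_abacus //.
under [X in _ = _ + X]eq_bigr do rewrite card_beads //.
under [X in _ + X = _]eq_bigr do rewrite card_beads //.
rewrite big_distrr -big_split /=.
under eq_bigr do rewrite sum_beads ?le_q //.
rewrite big_split -big_distrr /=; split; lia.
Qed.

(** * Translation of bead configurations *)

Definition normal_beads (r e w : nat) : set {fset nat} :=
  [set B | [/\ #|` B| = r, has_weight e B w &
               exists2 x, x \in B & x %% e = e.-1]].

Definition normal_intparts (r e w : nat) : set (seq nat) :=
  [set lambda | [/\ is_intpart lambda, size lambda <= r &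
                    normal_beads r e w (beads r lambda)]].

Lemma OmegaE r lambda (i : 'I_r.-1) :
  Omega r lambda 0%R i = ((beta r lambda i)%:Z - (beta r lambda i.+1)%:Z)%R.
Proof.
pose u := (\row_(j < r.-1) ((beta r lambda j)%:Z - (beta r lambda j.+1)%:Z))%R.
have -> : Omega r lambda = u.
  rewrite [u]row_sum_delta; apply: eq_bigr => j _.
  by rewrite /u mxE.
by rewrite /u mxE.
Qed.

(** Equality of consecutive differences, rearranged to avoid truncated subtraction. *)
Lemma eq_Omega r lambda kappa :
  Omega r lambda = Omega r kappa <->
  (forall i, i.+1 < r ->
     beta r lambda i + beta r kappa i.+1 = beta r kappa i + beta r lambda i.+1).
Proof.
split=> [eq_lk i lt_i|eq_b]; last first.
  apply/rowP => i; rewrite !OmegaE.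
  have := eq_b i; have := ltn_ord i; lia.
have lt_i' : i < r.-1 by lia.
have := congr1 (fun u : 'rV_r.-1 => u 0%R (Ordinal lt_i')) eq_lk.
rewrite /= !OmegaE /=; lia.
Qed.

(** Equal gaps propagate the difference at the last index to all smaller ones; the inequality there
    makes the shift a natural number. *)
Lemma eq_Omega_shift r lambda kappa : 0 < r -> Omega r lambda = Omega r kappa ->
  beta r lambda r.-1 <= beta r kappa r.-1 ->
  exists k, forall i, i < r -> beta r kappa i = beta r lambda i + k.
Proof.
move=> r_gt0 /eq_Omega eq_b le_b.
exists (beta r kappa r.-1 - beta r lambda r.-1) => i lt_i.
have [d] : exists d, i + d = r.-1 by exists (r.-1 - i); lia.
elim: d i lt_i => [|d IHd] i lt_i eq_i.
  by rewrite addn0 in eq_i; subst i; rewrite subnKC.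
have lt_i1 : i.+1 < r by lia.
have := IHd i.+1 lt_i1; have := eq_b i lt_i1; lia.
Qed.

Section Shift.

Variables (r e k : nat) (lambda kappa : seq nat).
Hypotheses (lP : is_intpart lambda) (kP : is_intpart kappa).
Hypothesis shift : forall i, i < r -> beta r kappa i = beta r lambda i + k.

Lemma congr_pairs_shift :
  congr_pairs e (beads r kappa) = congr_pairs e (beads r lambda).
Proof.
rewrite /congr_pairs !big_beads //; apply: eq_bigr => i _.
rewrite !big_beads //; apply: eq_bigr => j _.
by rewrite !shift // eqn_modDr.
Qed.

Lemma rowsum_shift :
  rowsum e (beads r kappa) = \sum_(i < r) (beta r lambda i + k) %/ e.
Proof.
rewrite /rowsum (big_beads _ (fun x => x %/ e)) //.
by apply: eq_bigr => i _; rewrite shift.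
Qed.

(** Since [congr_pairs] is translation invariant, equal weights mean equal row sums. A shift by
    [k > 0] decreases no row and strictly increases that of a bead on runner [e - 1]. *)
Lemma normal_shift w : 0 < e ->
  has_weight e (beads r lambda) w -> has_weight e (beads r kappa) w ->
  (exists2 x, x \in beads r lambda & x %% e = e.-1) -> k = 0.
Proof.
move=> e_gt0 /(has_weightE _ _ e_gt0) wl /(has_weightE _ _ e_gt0) wk.
case=> _ /mem_beads[i lt_i ->] eq_i.
have : rowsum e (beads r kappa) = rowsum e (beads r lambda).
  by move: wl wk; rewrite congr_pairs_shift !card_beads //; lia.
rewrite rowsum_shift /rowsum (big_beads _ (fun x => x %/ e)) //.
rewrite (bigD1 (Ordinal lt_i)) // [RHS](bigD1 (Ordinal lt_i)) //= => eq_s.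
case: (posnP k) => // k_gt0; exfalso.
have lt_row : beta r lambda i %/ e < (beta r lambda i + k) %/ e.
  rewrite leq_divRL // mulSn addnC [leqRHS](congr1 (addn^~ k) (divn_eq _ e)).
  rewrite eq_i -addnA leq_add2l; lia.
have : \sum_(j < r | j != Ordinal lt_i) beta r lambda j %/ e <=
       \sum_(j < r | j != Ordinal lt_i) (beta r lambda j + k) %/ e.
  by apply: leq_sum => j _; apply: leq_div2r; apply: leq_addr.
by move/(leq_add lt_row); rewrite eq_s addSn ltnn.
Qed.

End Shift.

Lemma Omega_normal_inj r e w : 0 < r -> 0 < e ->
  {in normal_intparts r e w &, injective (Omega r)}.
Proof.
move=> r_gt0 e_gt0 lambda kappa.
wlog le_lk : lambda kappa / beta r lambda r.-1 <= beta r kappa r.-1.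
  move=> IH lN kN eq_lk; case/orP: (leq_total (beta r lambda r.-1) (beta r kappa r.-1)).
    by move=> le_lk; apply: IH.
  by move=> le_kl; apply/esym/IH.
rewrite !inE => -[lP szl [_ wl xl]] [kP szk [_ wk _]] eq_lk.
have [k shift] := eq_Omega_shift r_gt0 eq_lk le_lk.
have k0 := normal_shift lP kP shift e_gt0 wl wk xl.
by apply: (beta_inj lP szl kP szk) => i lt_i; rewrite shift // k0 addn0.
Qed.

(* Shifting until the last nonempty runner becomes runner e - 1 makes no bead
   change rows, hence does not change the weight. *)
Lemma Omega_normal_surj r e w : 0 < r -> 0 < e ->
  [set Omega r lambda | lambda in normal_intparts r e w] = Wset r e w.
Proof.
move=> r_gt0 e_gt0; apply/seteqP; split=> [_ [lambda [lP szl [_ wl _]] <-]|].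
  by exists lambda.
move=> _ [lambda [lP szl wl] <-].
have [i0 _ i0P] := @arg_maxnP _ (Ordinal r_gt0) predT
  (fun j : 'I_r => beta r lambda j %% e) isT.
have i0_max (j : 'I_r) : beta r lambda j %% e <= beta r lambda i0 %% e by apply: i0P.
pose k := e.-1 - beta r lambda i0 %% e.
have lt_mod := ltn_pmod (beta r lambda i0) e_gt0.
have [|kappa [kP szk shift]] := @beta_surj r (fun i => beta r lambda i + k).
  by move=> i j lt_ij lt_j; rewrite ltn_add2r; apply: beta_dec.
(* By maximality of the residue of [i0], adding [k] takes no residue beyond [e - 1]. *)
have same_row (j : 'I_r) : (beta r lambda j + k) %/ e = beta r lambda j %/ e.
  rewrite {1}(divn_eq (beta r lambda j) e) -addnA divnMDl //.
  rewrite [X in _ + X]divn_small ?addn0 //.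
  have := i0_max j; rewrite /k; lia.
exists kappa; last first.
  by apply/eq_Omega => i lt_i; rewrite !shift //; [lia | exact: ltnW].
split=> //; split; first by rewrite card_beads.
  apply/has_weightE => //; move/has_weightE: wl => /(_ e_gt0).
  rewrite (congr_pairs_shift _ lP kP shift) (rowsum_shift _ kP shift) !card_beads //.
  by rewrite (eq_bigr _ (fun j _ => same_row j)) /rowsum (big_beads _ (fun x => x %/ e)).
exists (beta r kappa i0); first by apply/mem_beads; exists (nat_of_ord i0).
rewrite shift // (divn_eq (beta r lambda i0) e) -addnA modnMDl /k subnKC; last lia.
by rewrite modn_small // prednK.
Qed.

(** Both [Omega] and [beads r] are injective on [normal_intparts], which thus links the two sets. *)
Lemma card_Wset r e w : 0 < r -> 0 < e -> Wset r e w #= normal_beads r e w.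
Proof.
move=> r_gt0 e_gt0; rewrite -(Omega_normal_surj w r_gt0 e_gt0).
apply: card_eq_trans (inj_card_eq (Omega_normal_inj r_gt0 e_gt0)) _.
have <- : [set beads r lambda | lambda in normal_intparts r e w] = normal_beads r e w.
  apply/seteqP; split=> [_ [lambda [_ _ ?] <-] //|B BN].
  have [lambda [lP szl eq_B]] := beads_surj B; case: (BN) => eq_r _ _.
  by rewrite eq_r in szl eq_B; exists lambda => //; split=> //; rewrite eq_B.
apply: card_esym; apply: inj_card_eq => lambda kappa.
by rewrite !inE => -[lP szl _] [kP szk _]; apply: beads_inj.
Qed.

(** * Counting *)

(* From here on the abacus has e + 1 runners, so that ['I_e] indexes all of them
   but the last, which is always occupied. *)
Definition runners (e : nat) (S : {set 'I_e}) : seq nat :=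
  rcons [seq val b | b <- enum S] e.

Lemma size_runners e (S : {set 'I_e}) : size (runners S) = #|S|.+1.
Proof. by rewrite size_rcons size_map -cardE. Qed.

Lemma mem_runners e (S : {set 'I_e}) (b : 'I_e) : (val b \in runners S) = (b \in S).
Proof.
rewrite mem_rcons inE (ltn_eqF (ltn_ord b)) /= mem_map ?mem_enum //.
exact: val_inj.
Qed.

Lemma runners_lt e (S : {set 'I_e}) : {in runners S, forall b, b < e.+1}.
Proof.
move=> b; rewrite mem_rcons inE => /orP[/eqP-> //|/mapP[c _ ->]].
exact: ltnW (ltn_ord c).
Qed.

Lemma runners_uniq e (S : {set 'I_e}) : uniq (runners S).
Proof.
rewrite rcons_uniq map_inj_uniq ?enum_uniq ?andbT; last exact: val_inj.
by apply/negP => /mapP[b _ eq_b]; have := ltn_ord b; rewrite -eq_b ltnn.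
Qed.

Local Notation config e := (seq nat * (seq (seq nat) * {set 'I_e}))%type.

(** Triples (composition, multipartition, set of nonempty runners other than the last); the last
    runner accounts for the predecessor. *)
Definition configs (r e w : nat) : set (config e) :=
  [set p : config e | [/\ compositions r p.1, multipartitions p.1 w p.2.1 &
               #|p.2.2| = (size p.1).-1]].

Definition config_beads (e : nat) (p : config e) : {fset nat} :=
  abacus e.+1 (runners p.2.2) (fun i => beads (nth 0 p.1 i) (nth [::] p.2.1 i)).

(** As [r > 0], the composition is nonempty and the predecessor is not truncated. *)
Lemma size_configs r e w (p : config e) : 0 < r -> configs r w p ->
  size (runners p.2.2) = size p.1.
Proof.
move=> r_gt0 [/andP[_ /eqP sum_mu] _]; rewrite size_runners => ->.
by case: (p.1) sum_mu => // eq_r; rewrite -eq_r in r_gt0.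
Qed.

Lemma mem_config_beads e (p : config e) a i : i < size (runners p.2.2) ->
  (a * e.+1 + nth 0 (runners p.2.2) i \in config_beads p) =
  (a \in beads (nth 0 p.1 i) (nth [::] p.2.1 i)).
Proof.
move=> lt_i; apply: mem_abacus_nth lt_i; first exact: runners_uniq.
exact: runners_lt.
Qed.

(** Parts are positive, so every listed runner carries a bead. This makes the set of runners
    readable from the beads. *)
Lemma config_beads_runner r e w (p : config e) b : 0 < r -> configs r w p ->
  b \in runners p.2.2 -> exists2 x, x \in config_beads p & x %% e.+1 = b.
Proof.
move=> r_gt0 pP b_rs; have sz_p := size_configs r_gt0 pP.
case: pP => /andP[/allP mu_gt0 _] _ _.
have lt_i : index b (runners p.2.2) < size (runners p.2.2) by rewrite index_mem.
pose a := beta (nth 0 p.1 (index b (runners p.2.2)))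
               (nth [::] p.2.1 (index b (runners p.2.2))) 0.
exists (a * e.+1 + b); last by rewrite modnMDl modn_small // (runners_lt b_rs).
rewrite -[X in _ + X](nth_index 0 b_rs) mem_config_beads //.
by apply/mem_beads; exists 0 => //; apply: mu_gt0; rewrite mem_nth // -sz_p.
Qed.

Lemma config_beads_sub r e w (p p' : config e) : 0 < r -> configs r w p ->
  config_beads p = config_beads p' -> p.2.2 \subset p'.2.2.
Proof.
move=> r_gt0 pP eq_B; apply/fintype.subsetP => b; rewrite -!mem_runners => b_rs.
have [x xB <-] := config_beads_runner r_gt0 pP b_rs.
move: xB; rewrite eq_B mem_abacus ?runners_uniq //; last exact: runners_lt.
by case/andP.
Qed.

(** The beads determine the nonempty runners, then the occupied rows of each; the number of these
    rows is the part of [mu], and [beads_inj] recovers the partition. *)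
Lemma config_beads_inj r e w : 0 < r ->
  {in @configs r e w &, injective (@config_beads e)}.
Proof.
move=> r_gt0 p p'; rewrite !inE => pP p'P eq_B.
have eq_S : p.2.2 = p'.2.2.
  apply/eqP; rewrite finset.eqEsubset (config_beads_sub r_gt0 pP) //.
  by rewrite (config_beads_sub r_gt0 p'P).
have sz_p := size_configs r_gt0 pP; have sz_p' := size_configs r_gt0 p'P.
case: pP p'P => _ [sz_q /allP qP _ le_q] _ [_ [sz_q' /allP q'P _ le_q'] _].
have eq_T i : i < size p.1 -> beads (nth 0 p.1 i) (nth [::] p.2.1 i) =
                              beads (nth 0 p'.1 i) (nth [::] p'.2.1 i).
  rewrite -sz_p => lt_i; apply/fsetP => a.
  by rewrite -!mem_config_beads -?eq_S // eq_B.
have sz_pp' : size p.1 = size p'.1 by rewrite -sz_p -sz_p' eq_S.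
have q_int i : i < size p.1 -> is_intpart (nth [::] p.2.1 i).
  by move=> lt_i; apply/qP/mem_nth; rewrite sz_q.
have q'_int i : i < size p.1 -> is_intpart (nth [::] p'.2.1 i).
  by move=> lt_i; apply/q'P/mem_nth; rewrite sz_q' -sz_pp'.
have eq_mu : p.1 = p'.1.
  apply: (eq_from_nth (x0 := 0)) => // i lt_i.
  by rewrite -(card_beads (nth 0 p.1 i) (q_int i lt_i)) eq_T // card_beads // q'_int.
have eq_q : p.2.1 = p'.2.1.
  apply: (eq_from_nth (x0 := [::])) => [|i]; first by rewrite sz_q sz_pp'.
  rewrite sz_q => lt_i; apply: (@beads_inj (nth 0 p.1 i)).
  all: rewrite ?q_int ?q'_int ?le_q //.
    by rewrite eq_mu le_q' // -sz_pp'.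
  by rewrite eq_T // eq_mu.
rewrite [p]surjective_pairing [p.2]surjective_pairing eq_mu eq_q eq_S.
by rewrite -!surjective_pairing.
Qed.

Lemma config_beads_normal r e w (p : config e) : 0 < r -> configs r w p ->
  normal_beads r e.+1 w (config_beads p).
Proof.
move=> r_gt0 pP; have sz_p := size_configs r_gt0 pP.
have [/andP[_ /eqP sum_mu] [sz_q qP sum_q le_q] _] := pP.
split.
- rewrite card_abacus ?runners_uniq //; last exact: runners_lt.
  rewrite -sum_mu sumnE (big_nth 0) big_mkord sz_p; apply: eq_bigr => i _.
  by rewrite card_beads //; apply/(allP qP)/mem_nth; rewrite sz_q.
- apply/weight_abacus; rewrite ?runners_uniq ?sz_p ?sz_q //.
  exact: runners_lt.
- by apply: (config_beads_runner r_gt0 pP); rewrite mem_rcons mem_head.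
Qed.

Lemma config_beads_surj r e w (B : {fset nat}) : normal_beads r e.+1 w B ->
  exists2 p : config e, configs r w p & config_beads p = B.
Proof.
case=> card_B wB [z zB zE].
pose row b : {fset nat} := [fset x %/ e.+1 | x in B & x %% e.+1 == b]%fset.
have row_mem x : (x \in B) = (x %/ e.+1 \in row (x %% e.+1)).
  apply/idP/imfsetP => /= [xB|[y]]; first by exists x; rewrite ?inE ?xB ?eqxx.
  rewrite !inE => /andP[yB /eqP eq_m] eq_d.
  by rewrite (divn_eq x e.+1) -eq_m eq_d -divn_eq.
pose S := [set b : 'I_e | row b != fset0]%SET.
(* For every runner, a partition whose beta numbers are the occupied rows. *)
have [part partP] := choice (fun b => beads_surj (row b)).
pose mu := [seq #|` row b| | b <- runners S].
pose q := [seq part b | b <- runners S].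
have nth_mu i : i < size (runners S) -> nth 0 mu i = #|` row (nth 0 (runners S) i)|.
  by move=> lt_i; rewrite (nth_map 0).
have nth_q i : i < size (runners S) -> nth [::] q i = part (nth 0 (runners S) i).
  by move=> lt_i; rewrite (nth_map 0).
have beads_i i : i < size (runners S) ->
    beads (nth 0 mu i) (nth [::] q i) = row (nth 0 (runners S) i).
  by move=> lt_i; rewrite nth_mu // nth_q //; have [] := partP (nth 0 (runners S) i).
(* [S] cannot record the last runner; that one is nonempty because it carries [z]. *)
have row_neq0 b : (b < e.+1) -> (row b != fset0) = (b \in runners S).
  rewrite ltnS leq_eqVlt => /orP[/eqP-> | lt_b].
    rewrite mem_rcons mem_head; apply/fset0Pn; exists (z %/ e.+1).
    by have := row_mem z; rewrite zE zB /= => <-.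
  by rewrite -[b in RHS]/(val (Ordinal lt_b)) mem_runners inE.
have eq_B : config_beads (mu, (q, S)) = B.
  apply/fsetP => x; rewrite mem_abacus ?runners_uniq //; last exact: runners_lt.
  rewrite row_mem /= -row_neq0 ?ltn_pmod //.
  have [row0|row_x] /= := eqVneq (row (x %% e.+1)) fset0.
    by rewrite row0 inE.
  by rewrite beads_i ?index_mem -?row_neq0 ?ltn_pmod // nth_index // -row_neq0 ?ltn_pmod.
have q_int : all is_intpart q.
  by apply/allP => _ /mapP[b _ ->]; have [] := partP b.
have le_q i : i < size (runners S) -> size (nth [::] q i) <= nth 0 mu i.
  by move=> lt_i; rewrite nth_mu // nth_q //; have [] := partP (nth 0 (runners S) i).
have sum_q : \sum_(i < size (runners S)) sumn (nth [::] q i) = w.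
  have [||||||| sum_q _] // := @weight_abacus e.+1 (runners S) mu q w.
  - exact: runners_uniq.
  - exact: runners_lt.
  - by rewrite !size_map.
  - by rewrite size_map.
  - by apply: sum_q; rewrite -[abacus _ _ _]/(config_beads (mu, (q, S))) eq_B.
exists (mu, (q, S)) => //; split=> /=.
- apply/andP; split.
    apply/allP => _ /mapP[b b_rs ->].
    by rewrite -[ltn _ _]/(0 < _) cardfs_gt0 row_neq0 ?(runners_lt b_rs).
  rewrite -card_B -eq_B card_abacus ?runners_uniq //; last exact: runners_lt.
  rewrite sumnE (big_nth 0) big_mkord size_map; apply/eqP/eq_bigr => i _.
  by rewrite /= beads_i // nth_mu.
- by split; rewrite ?size_map.
- by rewrite size_map size_runners.
Qed.

(** Once [mu] is fixed, the multipartition and the set of runners vary independently. The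
    repetition-free list [L] enumerates all triples. *)
Lemma card_configs r e w : @configs r e w #=
  `I_(\sum_(mu <- fset_set (compositions r)) A mu w * 'C(e, (size mu).-1)).
Proof.
pose draws k := enum [set S : {set 'I_e} | #|S| == k]%SET.
pose qS (mu : seq nat) := [seq (q, X) | q <- fset_set (multipartitions mu w),
                                        X <- draws (size mu).-1].
pose L : seq (config e) := [seq (mu, x) | mu <- fset_set (compositions r), x <- qS mu].
have uqS mu : uniq (qS mu).
  by apply: allpairs_uniq; rewrite ?fset_uniq ?enum_uniq // => -[? ?] [? ?].
have uL : uniq L.
  apply: allpairs_uniq_dep; first exact: fset_uniq.
    by move=> mu _; apply: uqS.
  by move=> [mu x] [mu' x'] _ _ /= [-> ->].
(* Finiteness enters here: membership in [fset_set] agrees with membership in the set only for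
   finite sets. *)
have -> : @configs r e w = [set` [fset p in L]%fset].
  apply/seteqP; split=> [[mu [q S]] [/= muP qP SP]|p /=]; rewrite !inE.
    apply/allpairsPdep; exists mu, (q, S); split=> //.
      by rewrite in_fset_set ?inE //; exact: finite_compositions.
    apply/allpairsPdep; exists q, S; split=> //.
      by rewrite in_fset_set ?inE //; exact: finite_multipartitions.
    by rewrite mem_enum inE SP.
  case/allpairsPdep => mu [x [mu_in /allpairsPdep[q [S [q_in S_in ->]]] ->]].
  move: mu_in; rewrite in_fset_set ?inE => [muP|]; last exact: finite_compositions.
  move: q_in; rewrite in_fset_set ?inE => [qP|]; last exact: finite_multipartitions.
  by move: S_in; rewrite mem_enum inE => /eqP SP; split.
apply/card_eq_fsetP; rewrite card_fseq undup_id // size_allpairs_dep sumnE big_map.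
apply: eq_bigr => mu _; rewrite size_allpairs; congr muln.
by rewrite /draws -cardE card_draws card_ord.
Qed.

Unset Implicit Arguments.

Theorem theorem3p15 (r e w : nat) (hr : 3 <= r) (he : r < e) :
  Wset r e w #=
  `I_(\sum_(mu <- fset_set (compositions r)) A mu w * 'C(e.-1, (size mu).-1)).
Proof.
have r_gt0 : 0 < r by apply: leq_trans hr.
(* With [e.+1] for the number of runners, the binomial counts subsets of the [e] runners other than
   the last. *)
case: e he => // e _; apply: card_eq_trans (card_Wset w r_gt0 (ltn0Sn e)) _.
apply: card_eq_trans (card_configs r e w).
have <- : [set config_beads p | p in @configs r e w] = normal_beads r e.+1 w.
  apply/seteqP; split=> [_ [p pP <-]|B /config_beads_surj[p pP <-]].
    exact: config_beads_normal.
  by exists p.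
exact/inj_card_eq/config_beads_inj.
Qed.
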